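(* Let $m\in\mathbb N$ and let $(X^1_n)_{n\in\mathbb N},\dots,(X^m_n)_{n\in\mathbb N}$ be sequences of integrable real random variables adapted to a common filtration $(\mathcal A_n)_{n\in\mathbb N}$, with Doob decompositions $$X_n^i=X_1^i+M_n^i+\sum_{k=1}^{n-1}Y^i_k,\qquad i=1,\dots,m,$$ where $(M^i_n)_{n}$ is a zero mean martingale and $Y^i_k=E(X^i_{k+1}\mid\mathcal A_k)-X^i_k$. Assume that for each $i$ the sequence $(Y^i_k)_{k\in\mathbb N}$ is non-increasing in $k$. Put $X_n=\sum_{i=1}^mX_n^i$. Then: (i) The stopping problem for $(X_n)_{n\in\mathbb N}$ is a monotone case problem, with myopic rule $$\tau^*=\inf\Big\{k:\ \sum_{i=1}^mY^i_k\leq 0\Big\}.$$ (ii) If $$\lim_{L\to\infty}EX_{\min\{\tau^*,L\}}\leq EX_{\tau^*}\qquad\text{and}\qquad \sup\{EX_\tau:\tau\text{ a bounded stopping time}\}=\sup_\tau EX_\tau ,$$ then $\tau^*$ is optimal, i.e. $EX_{\tau^*}=\sup_\tau EX_\tau$.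
   Context: $\mathbb N=\{1,2,\dots\}$. All stopping times are with respect to $(\mathcal A_n)_{n\in\mathbb N}$, take values in $\{1,2,\dots\}\cup\{\infty\}$ (not necessarily finite a.s.), and $X_\infty:=\liminf_{n\to\infty}X_n$. The supremum $\sup_\tau EX_\tau$ is over all stopping times $\tau$ for which $EX_\tau$ exists. The stopping problem for an adapted integrable sequence $(X_n)_{n\in\mathbb N}$ is called a monotone case problem if for all $n\in\mathbb N$ $$\{E(X_{n+1}\mid\mathcal A_n)\leq X_n\}\subseteq\{E(X_{n+2}\mid\mathcal A_{n+1})\leq X_{n+1}\}.$$ Its myopic rule (myopic stopping time) is $\tau^*=\inf\{n: E(X_{n+1}\mid\mathcal A_n)\leq X_n\}$, with $\inf\emptyset=\infty$. (In)equalities between random variables are understood almost surely. *)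

(* Defs.v *)
(* Time runs over {1, 2, ...}: processes and filtrations are functions of
   n : nat whose value at 0 is never constrained; every condition carries the
   guard (0 < n)%N.

   Conditional expectations are handled through their versions: Z is a version
   of E(X | G) when [cond_exp P G X Z] holds. All (in)equalities and inclusions
   involving such versions hold P-almost surely. *)
From HB Require Import structures.
From mathcomp Require Import all_boot all_order all_algebra.
From mathcomp Require Import all_classical all_reals all_analysis.

Set Implicit Arguments.
Unset Strict Implicit.
Unset Printing Implicit Defensive.

Import Order.TTheory GRing.Theory Num.Theory.
Import numFieldNormedType.Exports.

Local Open Scope classical_set_scope.
Local Open Scope ring_scope.

Definition filtration (d : measure_display) (T : measurableType d)
    (A : nat -> set (set T)) : Prop :=
  [/\ forall n, (0 < n)%N -> sigma_algebra setT (A n),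
      forall n, (0 < n)%N -> A n `<=` measurable
    & forall n, (0 < n)%N -> A n `<=` A n.+1].

Definition measurable_wrt (d : measure_display) (T : measurableType d)
    (R : realType) (G : set (set T)) (f : T -> R) : Prop :=
  forall B : set R, measurable B -> G (f @^-1` B).

Definition adapted (d : measure_display) (T : measurableType d) (R : realType)
    (A : nat -> set (set T)) (X : nat -> T -> R) : Prop :=
  forall n, (0 < n)%N -> measurable_wrt (A n) (X n).

Definition integrable_seq (d : measure_display) (T : measurableType d)
    (R : realType) (P : probability T R) (X : nat -> T -> R) : Prop :=
  forall n, (0 < n)%N -> P.-integrable setT (EFin \o X n).

Definition cond_exp (d : measure_display) (T : measurableType d) (R : realType)
    (P : probability T R) (G : set (set T)) (X Z : T -> R) : Prop :=
  [/\ measurable_wrt G Z,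
      P.-integrable setT (EFin \o Z)
    & forall B, G B ->
        (\int[P]_(w in B) (Z w)%:E = \int[P]_(w in B) (X w)%:E)%E].

Definition martingale (d : measure_display) (T : measurableType d)
    (R : realType) (P : probability T R) (A : nat -> set (set T))
    (M : nat -> T -> R) : Prop :=
  [/\ adapted A M, integrable_seq P M
    & forall n, (0 < n)%N -> cond_exp P (A n) (M n.+1) (M n)].

(* The third clause says that Y k is a version of E(X_{k+1} | A_k) - X_k. *)
Definition doob_decomposition (d : measure_display) (T : measurableType d)
    (R : realType) (P : probability T R) (A : nat -> set (set T))
    (X M Y : nat -> T -> R) : Prop :=
  [/\ martingale P A M,
      forall n, (0 < n)%N -> ('E_P[M n] = 0)%E,
      forall k, (0 < k)%N ->
        exists2 Z, cond_exp P (A k) (X k.+1) Z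
                 & forall w, Y k w = Z w - X k w
    & forall n, (0 < n)%N -> {ae P, forall w,
        X n w = X 1%N w + M n w + \sum_(1 <= k < n) Y k w}].

(* Random times are functions T -> option nat, with None standing for oo. *)
Definition time_le (t : option nat) (n : nat) : bool :=
  if t is Some k then (k <= n)%N else false.

Definition time_min (t : option nat) (L : nat) : option nat :=
  Some (if t is Some k then minn k L else L).

(* inf {n >= 1 | p n}, with inf of the empty set equal to oo *)
Definition first_time (p : nat -> bool) : option nat :=
  match pselect (exists n, (0 < n)%N && p n) with
  | left ex_p => Some (ex_minn ex_p)
  | right _ => None
  end.

Definition stopping_time (d : measure_display) (T : measurableType d)
    (A : nat -> set (set T)) (tau : T -> option nat) : Prop :=
  (forall w, tau w != Some 0%N) /\
  (forall n, (0 < n)%N -> A n [set w | time_le (tau w) n]).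

Definition bounded_time (T : Type) (tau : T -> option nat) : Prop :=
  exists N, forall w, time_le (tau w) N.

(* X_tau, extended-real valued since X_oo is the liminf of the X_n. *)
Definition stopped (d : measure_display) (T : measurableType d) (R : realType)
    (X : nat -> T -> R) (tau : T -> option nat) (w : T) : \bar R :=
  if tau w is Some n then (X n w)%:E else limn_einf (fun n => (X n w)%:E).

Definition stopped_mean (d : measure_display) (T : measurableType d)
    (R : realType) (P : probability T R) (X : nat -> T -> R)
    (tau : T -> option nat) : \bar R :=
  (\int[P]_w stopped X tau w)%E.

(* The expectation exists in [-oo, +oo] iff the positive or the negative part
   has finite expectation. If neither has, the library's integral takes the
   value +oo - oo = -oo. *)
Definition mean_exists (d : measure_display) (T : measurableType d)
    (R : realType) (P : probability T R) (X : nat -> T -> R)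
    (tau : T -> option nat) : Prop :=
  (\int[P]_w (stopped X tau)^\+ w < +oo)%E \/
  (\int[P]_w (stopped X tau)^\- w < +oo)%E.

Definition optimal_value (d : measure_display) (T : measurableType d)
    (R : realType) (P : probability T R) (A : nat -> set (set T))
    (X : nat -> T -> R) : \bar R :=
  ereal_sup [set stopped_mean P X tau |
    tau in [set tau | stopping_time A tau /\ mean_exists P X tau]].

Definition bounded_value (d : measure_display) (T : measurableType d)
    (R : realType) (P : probability T R) (A : nat -> set (set T))
    (X : nat -> T -> R) : \bar R :=
  ereal_sup [set stopped_mean P X tau |
    tau in [set tau | stopping_time A tau /\ bounded_time tau]].

Definition optimal (d : measure_display) (T : measurableType d)
    (R : realType) (P : probability T R) (A : nat -> set (set T))
    (X : nat -> T -> R) (tau : T -> option nat) : Prop :=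
  [/\ stopping_time A tau, mean_exists P X tau
    & stopped_mean P X tau = optimal_value P A X].

(* Z n is a version of E(X_{n+1} | A_n) for every n. *)
Definition one_step_cond_exp (d : measure_display) (T : measurableType d)
    (R : realType) (P : probability T R) (A : nat -> set (set T))
    (X Z : nat -> T -> R) : Prop :=
  forall n, (0 < n)%N -> cond_exp P (A n) (X n.+1) (Z n).

Definition monotone_case (d : measure_display) (T : measurableType d)
    (R : realType) (P : probability T R) (A : nat -> set (set T))
    (X : nat -> T -> R) : Prop :=
  [/\ adapted A X, integrable_seq P X
    & forall Z, one_step_cond_exp P A X Z ->
        forall n, (0 < n)%N -> {ae P, forall w,
          Z n w <= X n w -> Z n.+1 w <= X n.+1 w}].

(* tau is almost surely inf {n | E(X_{n+1} | A_n) <= X_n}. Versions of the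
   conditional expectations are a.s. unique, so this does not depend on the
   choice of Z. *)
Definition myopic_rule (d : measure_display) (T : measurableType d)
    (R : realType) (P : probability T R) (A : nat -> set (set T))
    (X : nat -> T -> R) (tau : T -> option nat) : Prop :=
  stopping_time A tau /\
  exists2 Z, one_step_cond_exp P A X Z
           & {ae P, forall w, tau w = first_time (fun n => Z n w <= X n w)}.

(* Main.v *)
(* Write Y = sum_i Y^i. Telescoping X_(min(tau, N)) over the events {tau > k},
   which lie in A_k, gives for every stopping time tau bounded by N
     E X_tau = E X_1 + sum_(1 <= k < N) E (Y_k; tau > k)
             <= E X_1 + sum_(1 <= k < N) E Y_k^+.
   Since Y is a.s. non-increasing, {tau* > k} = {Y_k > 0} a.s., so equality holds
   for min(tau*, N): it is optimal among the stopping times bounded by N, and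
   E X_(min(tau*, N)) is non-decreasing in N. *)
Require Import Defs.
From HB Require Import structures.
From mathcomp Require Import all_boot all_order all_algebra.
From mathcomp Require Import all_classical all_reals all_analysis.
From mathcomp Require Import measurable_realfun.

Set Implicit Arguments.
Unset Strict Implicit.
Unset Printing Implicit Defensive.

Import Order.TTheory GRing.Theory Num.Theory.
Import numFieldNormedType.Exports.

Local Open Scope classical_set_scope.
Local Open Scope ring_scope.


(** * Measurability relative to a sub-sigma-algebra *)

Section SubSigmaAlgebra.
Context (d : measure_display) (T : measurableType d) (R : realType).
Context (G : set (set T)) (hG : sigma_algebra setT G).
Implicit Types f g : T -> R.

(** The measurable sets of [g_sigma_algebraType G] are [G] itself, because [G] is already a
    sigma-algebra. Closure properties of measurable functions thereby transfer to
    [measurable_wrt]. *)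
Lemma measurable_wrtE f :
  measurable_wrt G f <->
  measurable_fun (setT : set (g_sigma_algebraType G))
    (f : g_sigma_algebraType G -> R).
Proof.
have GE : (measurable : set (set (g_sigma_algebraType G))) = G.
  exact: sigma_algebra_id.
split=> [fG _ B mB|mf B mB]; first by rewrite setTI GE; exact: fG.
by have := mf measurableT _ mB; rewrite setTI GE.
Qed.

Lemma measurable_wrtB f g :
  measurable_wrt G f -> measurable_wrt G g ->
  measurable_wrt G (fun w => f w - g w).
Proof.
by rewrite !measurable_wrtE => mf mg; apply: measurable_funB.
Qed.

Lemma measurable_wrt_sum (I : Type) (s : seq I) (h : I -> T -> R) :
  (forall i, measurable_wrt G (h i)) ->
  measurable_wrt G (fun w => \sum_(i <- s) h i w).
Proof.
move=> mh; apply/measurable_wrtE; apply: measurable_sum => i.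
exact/measurable_wrtE.
Qed.

End SubSigmaAlgebra.

(** * Conditional expectations: additivity and almost sure uniqueness *)

Section ConditionalExpectation.
Context (d : measure_display) (T : measurableType d) (R : realType).
Context (P : probability T R) (G : set (set T)).
Hypotheses (hG : sigma_algebra setT G) (G_sub : G `<=` measurable).

Lemma cond_exp_sum (I : Type) (s : seq I) (X Z : I -> T -> R) :
  (forall i, P.-integrable setT (EFin \o X i)) ->
  (forall i, cond_exp P G (X i) (Z i)) ->
  cond_exp P G (fun w => \sum_(i <- s) X i w) (fun w => \sum_(i <- s) Z i w).
Proof.
move=> iX cZ.
have sumE (h : I -> T -> R) : EFin \o (fun w => \sum_(i <- s) h i w) =
    (fun w => \sum_(i <- s) (EFin \o h i) w)%E.
  by apply/funext => w /=; rewrite sumEFin.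
split.
- by apply: measurable_wrt_sum => // i; case: (cZ i).
- by rewrite sumE; apply: integrable_sum => // i _; case: (cZ i).
move=> B GB; have mB := G_sub GB.
have iS (h : T -> R) : P.-integrable setT (EFin \o h) ->
    P.-integrable B (EFin \o h) by exact: integrableS.
rewrite -[LHS]/(integral P B (EFin \o _)) -[RHS]/(integral P B (EFin \o _)).
rewrite !sumE !integral_sum //.
- by apply: eq_bigr => i _; case: (cZ i) => _ _; exact.
- by move=> i; apply: iS.
- by move=> i; apply: iS; case: (cZ i).
Qed.


(** The event [B] where [Z] exceeds [Z'] lies in [G], so both versions have the same integral over
    it. Being positive on [B] with integral 0 there, [Z - Z'] forces [B] to be null. *)
Lemma cond_exp_le (X Z Z' : T -> R) :
  cond_exp P G X Z -> cond_exp P G X Z' ->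
  {ae P, forall w, Z w <= Z' w}.
Proof.
move=> [mZ iZ ZX] [mZ' iZ' Z'X].
pose B := [set w | 0 < Z w - Z' w].
have GB : G B.
  have -> : B = (fun w => Z w - Z' w) @^-1` `]0, +oo[%classic.
    by apply/seteqP; split=> w; rewrite /B /= in_itv /= andbT.
  by apply: measurable_wrtB => //; exact: measurable_itv.
have mB := G_sub GB.
have iS (h : T -> R) : P.-integrable setT (EFin \o h) ->
    P.-integrable B (EFin \o h) by exact: integrableS.
have mZZ' : measurable_fun B (fun w => (Z w)%:E - (Z' w)%:E)%E.
  exact: measurable_int (integrableB mB (iS _ iZ) (iS _ iZ')).
have : (\int[P]_(w in B) `|(Z w)%:E - (Z' w)%:E| = 0)%E.
  under eq_integral => w.
    rewrite inE => Bw; rewrite gee0_abs ?lee_fin ?ltW//; over.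
  rewrite (integralB_EFin mB (iS _ iZ) (iS _ iZ')) (ZX _ GB) (Z'X _ GB).
  by rewrite -(ZX _ GB) subee//; exact/integrable_fin_num/iS.
move=> /(ae_eq_integral_abs P mB mZZ'); apply: filterS => w wB.
rewrite leNgt; apply/negP => lt; have Bw : B w by rewrite /B /= subr_gt0.
by move: (wB Bw) => /= [] /eqP; rewrite (gt_eqF Bw).
Qed.

Lemma cond_exp_unique (X Z Z' : T -> R) :
  cond_exp P G X Z -> cond_exp P G X Z' ->
  {ae P, forall w, Z w = Z' w}.
Proof.
move=> cZ cZ'; have := cond_exp_le cZ cZ'; have := cond_exp_le cZ' cZ.
by apply: filterS2 => w ? ?; apply/le_anti/andP.
Qed.

End ConditionalExpectation.

(** * First times and filtrations *)

Lemma time_le_first_time (p : nat -> bool) n :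
  time_le (first_time p) n <-> exists k, [/\ (0 < k)%N, (k <= n)%N & p k].
Proof.
rewrite /first_time; case: pselect => [ex_p|nex_p] /=.
  case: ex_minnP => k /andP[k0 pk] k_min; split=> [kn|[j [j0 jn pj]]].
    by exists k.
  by apply: leq_trans jn; apply: k_min; rewrite j0.
by split=> // -[k [k0 _ pk]]; case: nex_p; exists k; rewrite k0.
Qed.

Lemma first_time_neq0 (p : nat -> bool) : first_time p != Some 0%N.
Proof.
rewrite /first_time; case: pselect => // ex_p.
by case: ex_minnP => -[].
Qed.

Lemma filtration_le (d : measure_display) (T : measurableType d)
    (A : nat -> set (set T)) (k n : nat) :
  filtration A -> (0 < k)%N -> (k <= n)%N -> A k `<=` A n.
Proof.
move=> [_ _ incA] k0; elim: n => [|n ih]; first by rewrite leqn0 => /eqP->.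
rewrite leq_eqVlt => /predU1P[->//|]; rewrite ltnS => kn.
by apply: subset_trans (ih kn) (incA _ _); exact: leq_trans kn.
Qed.

(** * Stopped means of a process [X] with drift [Y] *)

Section StoppedProcess.
Context (d : measure_display) (T : measurableType d) (R : realType).
Context (P : probability T R) (A : nat -> set (set T)).
Context (X Y : nat -> T -> R).
Hypothesis hA : filtration A.
Hypothesis intX : integrable_seq P X.
Hypothesis adY : adapted A Y.
Hypothesis condX : forall n, (0 < n)%N ->
  cond_exp P (A n) (X n.+1) (fun w => X n w + Y n w).

Local Notation trunc tau n := (fun w => time_min (tau w) n).

Lemma stopping_time_first_time_le0 :
  stopping_time A (fun w => first_time (fun k => Y k w <= 0)).
Proof.
split=> [w|n n0]; first exact: first_time_neq0.
have [sA _ _] := hA.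
(* The finite union over 1 <= k <= n is padded with [set0] to fit closure under countable unions. *)
pose F k := if (0 < k <= n)%N then [set w | Y k w <= 0] else set0.
have -> : [set w | time_le (first_time (fun k => Y k w <= 0)) n] =
    \bigcup_k F k.
  apply/seteqP; split=> w /=.
    move=> /time_le_first_time[k [k0 kn Yk]].
    by exists k => //; rewrite /F k0 kn.
  move=> [k _]; rewrite /F; case: ifP => // /andP[k0 kn] Yk.
  by apply/time_le_first_time; exists k.
have [A0 _ Abig] := sA n n0; apply: Abig => k; rewrite /F.
case: ifP => // /andP[k0 kn]; apply: (filtration_le hA k0 kn).
have -> : [set w | Y k w <= 0] = Y k @^-1` `]-oo, 0]%classic.
  by apply/seteqP; split=> w; rewrite /= in_itv.
by apply: adY => //; exact: measurable_itv.
Qed.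

Lemma integrable_drift n : (0 < n)%N -> P.-integrable setT (EFin \o Y n).
Proof.
move=> n0; have [_ iZ _] := condX n0.
have := integrableB measurableT iZ (intX n0); apply: eq_integrable => // w _.
by rewrite /= EFinD addrAC subee// add0e.
Qed.

Lemma integral_increment n B : (0 < n)%N -> A n B ->
  (\int[P]_(w in B) ((X n.+1 w - X n w)%:E) = \int[P]_(w in B) (Y n w)%:E)%E.
Proof.
move=> n0 AB; have [_ mA _] := hA; have mB := mA n n0 B AB.
have iS (h : T -> R) : P.-integrable setT (EFin \o h) ->
    P.-integrable B (EFin \o h) by exact: integrableS.
have [_ iZ /(_ _ AB) ZX] := condX n0.
under eq_integral do rewrite EFinB.
rewrite (integralB_EFin mB (iS _ (intX _)) (iS _ (intX n0)))// -ZX.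
rewrite -(integralB_EFin mB (iS _ iZ) (iS _ (intX n0))).
by apply: eq_integral => w _; rewrite -EFinB addrAC subrr add0r.
Qed.

Section StoppingTime.
Context (tau : T -> option nat) (tauS : stopping_time A tau).

(** The event {tau > n}; taking a complement includes the paths where [tau] is infinite. *)
Let after n := ~` [set w | time_le (tau w) n].

Lemma after_in n : (0 < n)%N -> A n (after n).
Proof.
move=> n0; have [sA _ _] := hA; have [_ AC _] := sA n n0.
by rewrite /after -setTD; apply: AC; case: tauS => _; exact.
Qed.

(** Raising the horizon by one changes the stopped value only on {tau > n}, where the time moves
    from n to n + 1. *)
Lemma stopped_step n :
  stopped X (trunc tau n.+1) =
  (stopped X (trunc tau n) \+
    (fun w => ((X n.+1 w - X n w)%:E)) \_ (after n))%E.
Proof.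
apply/funext => w; rewrite /stopped /= patchE.
case: ifPn; rewrite /after ?(inE, notin_setE) /=; case: (tau w) => [k|] /=.
- move=> /negP; rewrite -ltnNge => nk.
  by rewrite (minn_idPr nk) (minn_idPr (ltnW nk)) -EFinD addrC subrK.
- by move=> _; rewrite -EFinD addrC subrK.
- move=> /contrapT kn.
  by rewrite (minn_idPl kn) (minn_idPl (leqW kn)) adde0.
- by move=> /contrapT.
Qed.

Lemma integrable_stopped n : (0 < n)%N ->
  P.-integrable setT (stopped X (trunc tau n)).
Proof.
case: n => // n _; elim: n => [|n ih].
  (* Since [tau] is never 0, min(tau, 1) is 1 everywhere. *)
  have -> : stopped X (trunc tau 1) = EFin \o X 1%N; last exact: intX.
  apply/funext => w; rewrite /stopped /=.
  by case: (tauS) => /(_ w); case: (tau w) => [[|k]|].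
rewrite stopped_step; apply: integrableD => //.
have [_ mA _] := hA.
apply/(integrable_mkcond _ (mA n.+1 _ _ (after_in _))) => //.
apply: (@integrableS _ _ _ _ setT) => //; first exact/mA/after_in.
have := integrableB measurableT (intX (ltn0Sn n.+1)) (intX (ltn0Sn n)).
by apply: eq_integrable => // w _; rewrite EFinB.
Qed.


(** As {tau > n} lies in [A n], conditioning replaces the increment of [X] by [Y n] on that
    event. *)
Lemma stopped_mean_step n : (0 < n)%N ->
  stopped_mean P X (trunc tau n.+1) =
  (stopped_mean P X (trunc tau n) + \int[P]_(w in after n) (Y n w)%:E)%E.
Proof.
move=> n0; have [_ mA _] := hA; have An := after_in n0.
have mB := mA n n0 _ An.
rewrite /stopped_mean stopped_step integralD//; last 2 first.
- exact: integrable_stopped.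
- apply/(integrable_mkcond _ mB); apply: (@integrableS _ _ _ _ setT) => //.
  have := integrableB measurableT (intX (ltn0Sn n)) (intX n0).
  by apply: eq_integrable => // w _; rewrite EFinB.
by rewrite -integral_mkcond integral_increment.
Qed.

End StoppingTime.

Lemma stopped_mean_1 tau : stopping_time A tau ->
  stopped_mean P X (trunc tau 1) = (\int[P]_w (X 1%N w)%:E)%E.
Proof.
move=> tauS; apply: eq_integral => w _; rewrite /stopped /=.
by case: (tauS) => /(_ w); case: (tau w) => [[|k]|].
Qed.

(** * The myopic rule under a non-increasing drift *)

Section Myopic.
Hypothesis Y_noninc : forall k, (0 < k)%N -> {ae P, forall w, Y k.+1 w <= Y k w}.

Let taus := fun w => first_time (fun k => Y k w <= 0).

(** Countably many null sets are merged into one, so that monotonicity holds along whole paths and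
    the drifts at any two times can be compared. *)
Lemma ae_noninc : {ae P, forall w k n, (0 < k)%N -> (k <= n)%N -> Y n w <= Y k w}.
Proof.
have : {ae P, forall w k, (0 < k)%N -> Y k.+1 w <= Y k w}.
  apply: ae_foralln => -[|k]; first exact: aeW.
  by have := Y_noninc (ltn0Sn k); apply: filterS => w.
apply: filterS => w dec k n k0; elim: n => [|n ih].
  by rewrite leqn0 => /eqP->.
rewrite leq_eqVlt => /predU1P[->//|]; rewrite ltnS => kn.
by apply: le_trans (ih kn); apply: dec; exact: leq_trans kn.
Qed.

(** Before stopping, [Y n] is positive by definition of [taus]. Otherwise some [Y k] with k <= n is
    nonpositive, and monotonicity carries this sign to n. Cutting [Y n] to {tau* > n} thus yields
    its positive part almost surely. *)
Lemma integral_after_myopic n : (0 < n)%N ->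
  (\int[P]_(w in ~` [set w | time_le (taus w) n]) (Y n w)%:E =
   \int[P]_w (EFin \o Y n)^\+ w)%E.
Proof.
move=> n0; have [_ mA _] := hA.
have mB := mA n n0 _ (after_in stopping_time_first_time_le0 n0).
have iY := integrable_drift n0.
rewrite integral_mkcond; apply: ae_eq_integral => //.
- have /(integrable_mkcond _ mB) := integrableS measurableT mB (@subsetT _ _) iY.
  exact: measurable_int.
- exact/measurable_funepos/measurable_int/iY.
have := ae_noninc; apply: filterS => w dec _.
rewrite patchE funeposE; case: ifPn; rewrite ?(inE, notin_setE) /=.
  move=> /time_le_first_time tn; apply/esym/max_idPl; rewrite lee_fin ltW//.
  by rewrite ltNge; apply/negP => Yn; apply: tn; exists n.
move=> /contrapT/time_le_first_time[k [k0 kn Yk]].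
apply/esym/max_idPr; rewrite lee_fin.
exact: le_trans (dec _ _ k0 kn) Yk.
Qed.

(** Cutting to [B] leaves either [Y n] or 0, and both are at most the positive part. *)
Lemma integral_le_funepos n B : (0 < n)%N -> A n B ->
  (\int[P]_(w in B) (Y n w)%:E <= \int[P]_w (EFin \o Y n)^\+ w)%E.
Proof.
move=> n0 AB; have [_ mA _] := hA; have mB := mA n n0 _ AB.
have iY := integrable_drift n0.
rewrite integral_mkcond; apply: le_integral => //.
- exact/(integrable_mkcond _ mB)/(integrableS measurableT mB (@subsetT _ _) iY).
- exact: integrable_funepos.
move=> w _; rewrite patchE; case: ifP => _; last exact: funepos_ge0.
by rewrite funeposE le_max lexx.
Qed.

Lemma stopped_mean_le_myopic tau n : stopping_time A tau -> (0 < n)%N ->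
  (stopped_mean P X (trunc tau n) <= stopped_mean P X (trunc taus n))%E.
Proof.
move=> tauS; case: n => // n _; elim: n => [|n ih].
  by rewrite !stopped_mean_1//; exact: stopping_time_first_time_le0.
rewrite [leLHS]stopped_mean_step// [leRHS]stopped_mean_step//; last first.
  exact: stopping_time_first_time_le0.
apply: leeD => //; rewrite integral_after_myopic//.
by apply: integral_le_funepos => //; exact: after_in.
Qed.

(** Each increment is the integral of a positive part. The index is shifted because truncation at 0
    would involve the unconstrained [X 0]. *)
Lemma stopped_mean_myopic_nondecreasing :
  nondecreasing_seq (fun n => stopped_mean P X (trunc taus n.+1)).
Proof.
apply/nondecreasing_seqP => n; rewrite [leRHS]stopped_mean_step//.
  by rewrite integral_after_myopic// leeDl// integral_ge0// => w _; exact: funepos_ge0.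
exact: stopping_time_first_time_le0.
Qed.

Lemma stopped_mean_myopic_le_lim n : (0 < n)%N ->
  (stopped_mean P X (trunc taus n) <=
   limn (fun L => stopped_mean P X (trunc taus L)))%E.
Proof.
case: n => // n _.
(* The shifted sequence converges to its supremum, and the shift does not affect the limit. *)
have := ereal_nondecreasing_cvgn stopped_mean_myopic_nondecreasing.
rewrite (cvg_shiftS (fun L => stopped_mean P X (trunc taus L))) => /cvg_lim->//.
by apply: ereal_sup_ubound; exists n.
Qed.

Lemma myopic_optimal :
  (limn (fun L => stopped_mean P X (trunc taus L)) <=
    stopped_mean P X taus)%E ->
  bounded_value P A X = optimal_value P A X ->
  optimal P A X taus.
Proof.
move=> lim_le bounded_opt.
have tausS : stopping_time A taus := stopping_time_first_time_le0.
have le_taus n : (0 < n)%N ->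
    (stopped_mean P X (trunc taus n) <= stopped_mean P X taus)%E.
  by move=> n0; apply: le_trans lim_le; exact: stopped_mean_myopic_le_lim.
have taus_mean : mean_exists P X taus.
  (* If both parts had infinite mean, the integral would take the default value -oo. It would then
     lie below the finite number E X_1, which is the stopped mean at horizon 1. *)
  apply: contrapT => /not_orP[/negP + /negP]; rewrite -!leNgt !leye_eq.
  move=> /eqP pos /eqP neg.
  have := le_taus 1%N isT; rewrite {2}/stopped_mean integralE pos neg /=.
  rewrite leeNy_eq stopped_mean_1// => /eqP mean1.
  by have := integrable_fin_num measurableT (intX (ltn0Sn 0)); rewrite mean1.
split => //; apply/le_anti/andP; split.
  by apply: ereal_sup_ubound; exists taus.
(* The second assumption leaves only bounded competitors, and these are compared at a common finite
   horizon. *)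
rewrite -bounded_opt; apply: ge_ereal_sup => _ [tau [tauS [N tauN]] <-].
apply: le_trans (le_taus N.+1 isT).
(* A time bounded by [N] is unchanged by this truncation; the successor makes the horizon
   positive. *)
have -> : tau = trunc tau N.+1.
  apply/funext => w; move: (tauN w); case: (tau w) => // k kN.
  by rewrite /time_min (minn_idPl (leqW kN)).
exact: stopped_mean_le_myopic.
Qed.

Lemma myopic_rule_first_time : myopic_rule P A X taus.
Proof.
split; first exact: stopping_time_first_time_le0.
(* With this version, stopping when Z_n <= X_n means exactly Y_n <= 0, so the two times agree on
   every path. *)
exists (fun n w => X n w + Y n w) => //.
apply: aeW => w; congr first_time; apply/funext => n.
by rewrite gerDl.
Qed.

(** By uniqueness any version equals [X + Y] almost surely, which turns the inclusion into: Y_n <= 0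
    implies Y_(n+1) <= 0. *)
Lemma monotone_case_noninc : adapted A X -> monotone_case P A X.
Proof.
move=> adX; split=> // Z cZ n n0; have [sA mA _] := hA.
have ZE k (k0 : (0 < k)%N) : {ae P, forall w, Z k w = X k w + Y k w}.
  exact: (cond_exp_unique (sA k k0) (mA k k0) (cZ k k0) (condX k0)).
have := Y_noninc n0; have := ZE _ (ltn0Sn n); have := ZE _ n0.
apply: filterS3 => w -> -> dec; rewrite !gerDl.
exact: le_trans.
Qed.

End Myopic.
End StoppedProcess.

(** * Reduction to the summed process, whose drift is the sum of the [Y i] *)

Theorem proposition3p1 (d : measure_display) (T : measurableType d)
    (R : realType) (P : probability T R) (A : nat -> set (set T))
    (m : nat) (X M Y : 'I_m -> nat -> T -> R)
    (hA : filtration A) (hm : (0 < m)%N)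
    (hXadapted : forall i, adapted A (X i))
    (hXint : forall i, integrable_seq P (X i))
    (hDoob : forall i, doob_decomposition P A (X i) (M i) (Y i))
    (hY : forall i k, (0 < k)%N -> {ae P, forall w, Y i k.+1 w <= Y i k w}) :
  let Xsum := fun (n : nat) (w : T) => \sum_(i < m) X i n w in
  let taus := fun w : T =>
    first_time (fun k => \sum_(i < m) Y i k w <= 0) in
  (monotone_case P A Xsum /\ myopic_rule P A Xsum taus) /\
  ((limn (fun L : nat => stopped_mean P Xsum (fun w => time_min (taus w) L))
      <= stopped_mean P Xsum taus)%E ->
   bounded_value P A Xsum = optimal_value P A Xsum ->
   optimal P A Xsum taus).
Proof.
move=> Xsum taus; have [sA mA _] := hA.
have condXi i n : (0 < n)%N ->
    cond_exp P (A n) (X i n.+1) (fun w => X i n w + Y i n w).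
  move=> n0; have [_ _ /(_ _ n0)[Z cZ YE] _] := hDoob i.
  suff <- : Z = (fun w => X i n w + Y i n w) by [].
  by apply/funext => w; rewrite YE addrC subrK.
have adYi i : adapted A (Y i).
  move=> n n0; have [mZ _ _] := condXi i n n0.
  (* Adaptedness of the drift comes from writing it as a version of the conditional expectation
     minus [X i n]. *)
  have -> : Y i n = (fun w => X i n w + Y i n w - X i n w).
    by apply/funext => w; rewrite addrAC subrr add0r.
  by apply: measurable_wrtB => //; [exact: sA|exact: hXadapted].
pose Ysum n w := \sum_(i < m) Y i n w.
have adX : adapted A Xsum.
  by move=> n n0; apply: measurable_wrt_sum; [exact: sA|move=> i; exact: hXadapted].
have adY : adapted A Ysum.
  by move=> n n0; apply: measurable_wrt_sum; [exact: sA|move=> i; exact: adYi].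
have intX : integrable_seq P Xsum.
  move=> n n0; have -> : EFin \o Xsum n =
      (fun w => \sum_(i < m) (EFin \o X i n) w)%E.
    by apply/funext => w /=; rewrite sumEFin.
  by apply: integrable_sum => // i _; exact: hXint.
have condX n : (0 < n)%N ->
    cond_exp P (A n) (Xsum n.+1) (fun w => Xsum n w + Ysum n w).
  move=> n0; under [X in cond_exp _ _ _ X]eq_fun do rewrite -big_split.
  apply: cond_exp_sum; [exact: sA|exact: mA| |].
    by move=> i; exact: hXint.
  by move=> i; exact: condXi.
have Y_noninc k : (0 < k)%N -> {ae P, forall w, Ysum k.+1 w <= Ysum k w}.
  (* The index [i] ranges over a finite type, so one null set serves all summands. *)
  move=> k0; have : {ae P, forall w i, Y i k.+1 w <= Y i k w}.
    by apply: filter_forall => i; exact: hY.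
  by apply: filterS => w dec; apply: ler_sum => i _; exact: dec.
split; first split.
- exact: monotone_case_noninc condX Y_noninc adX.
- exact: myopic_rule_first_time adY condX.
- exact: myopic_optimal adY condX Y_noninc.
Qed.
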